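(* Let $\Gamma$ be a strongly regular graph with $v$ vertices, let $\mathcal{I}^+$ be a positive intriguing set of $\Gamma$ and let $\mathcal{I}^-$ be a negative intriguing set of $\Gamma$. Then $$|\mathcal{I}^+\cap\mathcal{I}^-| = \frac{|\mathcal{I}^+|\,|\mathcal{I}^-|}{v}.$$
   Context: A regular graph $\Gamma$ with $v$ vertices and valency $k$ is strongly regular with parameters $(v,k,\lambda,\mu)$ if any two adjacent vertices have exactly $\lambda$ common neighbours and any two distinct non-adjacent vertices have exactly $\mu$ common neighbours. Strongly regular graphs are assumed to be connected and not complete, so the adjacency matrix has three distinct eigenvalues: $k$ (with eigenspace spanned by the all-ones vector), $e^+\ge 0$ and $e^-<0$. A nonempty proper subset $\mathcal{I}$ of the vertex set is an intriguing set with intersection numbers (parameters) $(h_1,h_2)$ if every vertex of $\mathcal{I}$ is adjacent to exactly $h_1$ vertices of $\mathcal{I}$ and every vertex not in $\mathcal{I}$ is adjacent to exactly $h_2$ vertices of $\mathcal{I}$. For such a set $h_1-h_2$ is an eigenvalue of the adjacency matrix; $\mathcal{I}$ is positive if $h_1-h_2=e^+$ and negative if $h_1-h_2=e^-$. *)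

(* Defs.v *)
From mathcomp Require Import all_boot all_order all_algebra.

Set Implicit Arguments.
Unset Strict Implicit.
Unset Printing Implicit Defensive.

Import GRing.Theory Num.Theory.
Local Open Scope ring_scope.

Section Graphs.

Variables (T : finType) (e : rel T).

Definition neighbours (x : T) : {set T} := [set y | e x y].

Definition simple_graph : Prop := symmetric e /\ irreflexive e.

Definition regular (k : nat) : Prop := forall x, #|neighbours x| = k.

Definition connected_graph : Prop := forall x y, connect e x y.

Definition complete_graph : Prop := forall x y, x != y -> e x y.

(* Connectedness and non-completeness are part of the definition, so that the
   degenerate parameter sets are excluded. *)
Definition strongly_regular (v k lambda mu : nat) : Prop :=
  [/\ [/\ simple_graph, #|T| = v & regular k],
      forall x y, e x y -> #|neighbours x :&: neighbours y| = lambda,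
      forall x y, x != y -> ~~ e x y -> #|neighbours x :&: neighbours y| = mu,
      connected_graph
    & ~ complete_graph].

Definition intriguing (I : {set T}) (h1 h2 : nat) : Prop :=
  [/\ I != set0,
      I \proper [set: T],
      forall x, x \in I -> #|neighbours x :&: I| = h1
    & forall x, x \notin I -> #|neighbours x :&: I| = h2].

Variable R : rcfType.

Definition adjacency_mx : 'M[R]_#|T| :=
  \matrix_(i, j) (e (enum_val i) (enum_val j))%:R.

(* In a strongly regular graph of valency k the adjacency matrix has exactly
   three eigenvalues k, e^+ >= 0 and e^- < 0, so e^+ (resp. e^-) is the
   nonnegative (resp. negative) eigenvalue distinct from k. *)
Definition is_eplus (k : nat) (a : R) : Prop :=
  [/\ eigenvalue adjacency_mx a, a != k%:R & 0 <= a].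

Definition is_eminus (k : nat) (a : R) : Prop :=
  [/\ eigenvalue adjacency_mx a, a != k%:R & a < 0].

Definition positive_intriguing (k : nat) (I : {set T}) : Prop :=
  exists h1 h2 : nat, intriguing I h1 h2 /\ is_eplus k (h1%:R - h2%:R).

Definition negative_intriguing (k : nat) (I : {set T}) : Prop :=
  exists h1 h2 : nat, intriguing I h1 h2 /\ is_eminus k (h1%:R - h2%:R).

End Graphs.

(* Main.v *)
Require Import Defs.
From mathcomp Require Import all_boot all_order all_algebra.
From mathcomp Require Import ring.
Local Open Scope ring_scope.

Import Order.TTheory GRing.Theory Num.Theory.

(** Let [I] and [J] be intriguing sets of a regular graph of valency [k] with
    [v] vertices, let their intersection numbers be [(h1, h2)] and [(g1, g2)],
    and put [a = h1 - h2], [b = g1 - g2].  Counting the adjacent pairs in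
    [J * I] from the side of [J], a vertex contributes [h2], plus a further [a]
    when it lies in [I]; so there are [a |I & J| + h2 |J|] such pairs
    ([sum_neighbours_intriguing]).  Counting from the side of [I] gives
    [b |I & J| + g2 |I|], and adjacency is symmetric, so the two agree:
    [(a - b) |I & J| = g2 |I| - h2 |J|].  Replacing one of the two sets by the
    whole vertex set turns the same double count into [h2 v = (k - a) |I|] and
    [g2 v = (k - b) |J|].  Substituting, the right-hand side becomes
    [(a - b) |I| |J| / v], and [a - b] cancels as soon as [a != b].  For a
    positive and a negative intriguing set this holds because [b < 0 <= a].
    This is the combinatorial form of the orthogonality of eigenvectors of a
    symmetric matrix that belong to distinct eigenvalues, the eigenvectors
    being the indicators of [I] and [J] projected off the all-ones vector. *)

Section IntriguingSets.

Variables (F : numFieldType) (T : finType) (e : rel T).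
Implicit Types (I J : {set T}).

Lemma sum_neighbours_sym I J : symmetric e ->
  (\sum_(x in J) #|neighbours e x :&: I| =
   \sum_(x in I) #|neighbours e x :&: J|)%N.
Proof.
move=> e_sym.
have cardE x (K : {set T}) :
    #|neighbours e x :&: K| = (\sum_(y in K) e x y)%N.
  rewrite -sum1_card big_mkcond [RHS]big_mkcond /=; apply: eq_bigr => y _.
  by rewrite !inE andbC; case: (y \in K); case: (e x y).
under eq_bigr do rewrite cardE.
rewrite exchange_big /=; apply: eq_bigr => x _; rewrite cardE.
by apply: eq_bigr => y _; rewrite e_sym.
Qed.

(** The pairing of the indicator of [J] with the relation
    [A 1_I = (h1 - h2) 1_I + h2 1] that defines an intriguing set, [A] being
    the adjacency matrix. *)
Lemma sum_neighbours_intriguing I J h1 h2 : intriguing e I h1 h2 ->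
  (\sum_(x in J) #|neighbours e x :&: I|)%:R =
  (h1%:R - h2%:R) * #|I :&: J|%:R + h2%:R * #|J|%:R :> F.
Proof.
case=> _ _ h1P h2P.
rewrite (big_setID I) /=.
under eq_bigr => x /setIP[_ xI] do rewrite (h1P x xI).
under [X in (_ + X)%N]eq_bigr => x /setDP[_ xI] do rewrite (h2P x xI).
rewrite !sum_nat_const -(cardsID I J) (setIC I J) !natrD !natrM.
by ring.
Qed.

(** The double count against the whole vertex set, where every vertex of [I]
    sees all of its [k] neighbours. *)
Lemma intriguing_regular_eq {k I h1 h2} :
  symmetric e -> regular e k -> intriguing e I h1 h2 ->
  h2%:R * #|T|%:R = (k%:R - (h1%:R - h2%:R)) * #|I|%:R :> F.
Proof.
move=> e_sym e_reg intI.
have := sum_neighbours_intriguing I [set: T] h1 h2 intI.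
rewrite sum_neighbours_sym // setIT cardsT.
under eq_bigr do rewrite setIT e_reg.
rewrite sum_nat_const natrM => eq_kI.
by rewrite mulrBl (mulrC k%:R) eq_kI addrC addKr.
Qed.

(** Of the valency and the intersection numbers only [h1 - h2 != g1 - g2]
    matters, because the double count determines [(a - b) |I & J|], with
    [a = h1 - h2] and [b = g1 - g2], and nothing else about [I & J]. *)
Lemma card_setI_intriguing k I J h1 h2 g1 g2 :
    symmetric e -> regular e k ->
    intriguing e I h1 h2 -> intriguing e J g1 g2 ->
    h1%:R - h2%:R != g1%:R - g2%:R :> F ->
  #|I :&: J|%:R = #|I|%:R * #|J|%:R / #|T|%:R :> F.
Proof.
move=> e_sym e_reg intI intJ neq_ab.
have v_neq0 : #|T|%:R != 0 :> F.
  case: intI => /set0Pn[x _] _ _ _.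
  by rewrite pnatr_eq0 -lt0n; apply/card_gt0P; exists x.
have := sum_neighbours_intriguing I J h1 h2 intI.
rewrite sum_neighbours_sym // (sum_neighbours_intriguing J I g1 g2 intJ).
rewrite (setIC J I).
have := intriguing_regular_eq e_sym e_reg intI.
have := intriguing_regular_eq e_sym e_reg intJ.
move: neq_ab; set a := h1%:R - h2%:R; set b := g1%:R - g2%:R => neq_ab.
move=> eqJ eqI double_count.
apply: (mulIf v_neq0); rewrite divfK //.
apply: (@mulfI _ (a - b)); first by rewrite subr_eq0.
(* Multiples of the three counts are collected here; the last summand is the
   difference of the two sides of the double count, hence zero. *)
have -> : (a - b) * (#|I :&: J|%:R * #|T|%:R) =
    (g2%:R * #|T|%:R) * #|I|%:R - (h2%:R * #|T|%:R) * #|J|%:R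
    + ((a * #|I :&: J|%:R + h2%:R * #|J|%:R)
       - (b * #|I :&: J|%:R + g2%:R * #|I|%:R)) * #|T|%:R by ring.
by rewrite double_count eqI eqJ; ring.
Qed.

End IntriguingSets.

Theorem lemma2p2 (R : rcfType) (T : finType) (e : rel T)
    (v k lambda mu : nat) (Ipos Ineg : {set T}) :
  strongly_regular e v k lambda mu ->
  positive_intriguing e R k Ipos ->
  negative_intriguing e R k Ineg ->
  #|Ipos :&: Ineg|%:R = #|Ipos|%:R * #|Ineg|%:R / v%:R :> R.
Proof.
case=> [[[e_sym _] <- e_reg] _ _ _ _].
case=> h1 [h2 [intpos [_ _ a_ge0]]] [g1 [g2 [intneg [_ _ b_lt0]]]].
apply: card_setI_intriguing e_sym e_reg intpos intneg _.
by rewrite gt_eqF // (lt_le_trans b_lt0 a_ge0).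
Qed.
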